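(* Assume $\mathfrak b>\aleph_1$. Let $Y$ be a metric space and let $\{X_i\}_{i\in I}$ be an uncountable family of metric spaces such that each $X_i$ coarsely embeds into $Y$. Then there is an uncountable subset $J\subseteq I$ such that the family $\{X_i\}_{i\in J}$ equi-coarsely embeds into $Y$.
   Context: For $f,g\colon\mathbb N\to\mathbb N$, write $f<^*g$ if there is $n$ such that $f(m)<g(m)$ for all $m\geqslant n$. A family $F\subseteq\mathbb N^{\mathbb N}$ is bounded if there is $g\in\mathbb N^{\mathbb N}$ with $f<^*g$ for all $f\in F$, and unbounded otherwise. The bounding number is $\mathfrak b=\min\{|F|: F\subseteq\mathbb N^{\mathbb N}\text{ is unbounded}\}$. A metric space $X$ coarsely embeds into $Y$ if there are a map $\phi\colon X\to Y$ and non-decreasing functions $\kappa,\omega\colon[0,\infty)\to[0,\infty)$ with $\lim_{t\to\infty}\kappa(t)=\infty$ and $$\kappa(d_X(x,x'))\leqslant d_Y(\phi(x),\phi(x'))\leqslant\omega(d_X(x,x'))\quad\text{for all }x,x'\in X.$$ A family $\{X_i\}_{i\in J}$ equi-coarsely embeds into $Y$ if all the $X_i$ coarsely embed into $Y$ with the same moduli, i.e., there is a single pair of non-decreasing functions $\kappa,\omega\colon[0,\infty)\to[0,\infty)$ with $\lim_{t\to\infty}\kappa(t)=\infty$ for which every $X_i$, $i\in J$, admits a map $\phi_i\colon X_i\to Y$ satisfying $$\kappa(d_{X_i}(x,x'))\leqslant d_Y(\phi_i(x),\phi_i(x'))\leqslant\omega(d_{X_i}(x,x'))\quad\text{for all }x,x'\in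 X_i.$$ *)

(* Defs.v *)
From HB Require Import structures.
From mathcomp Require Import all_boot all_order all_algebra.
From mathcomp Require Import boolp classical_sets functions cardinality.
From mathcomp Require Import reals topology normedtype.

Set Implicit Arguments.
Unset Strict Implicit.
Unset Printing Implicit Defensive.

Import Order.TTheory GRing.Theory Num.Theory.
Import numFieldNormedType.Exports.

Local Open Scope classical_set_scope.
Local Open Scope card_scope.
Local Open Scope ring_scope.

Definition eventually_lt (f g : nat -> nat) : Prop :=
  exists n : nat, forall m : nat, (n <= m)%N -> (f m < g m)%N.

Definition bounded_family (F : set (nat -> nat)) : Prop :=
  exists g : nat -> nat, forall f, F f -> eventually_lt f g.

Definition unbounded_family (F : set (nat -> nat)) : Prop :=
  ~ bounded_family F.

(* The library compares cardinals of sets without having cardinals as objects,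
   so a cardinal is given by the predicate "this set has that cardinality". *)

(* |F| = b: F is an unbounded family of least cardinality. *)
Definition has_card_bounding_number (F : set (nat -> nat)) : Prop :=
  unbounded_family F /\
  forall G : set (nat -> nat), unbounded_family G -> F #<= G.

(* |A| = aleph_1: A is uncountable of least cardinality. *)
Definition has_card_aleph1 (T : Type) (A : set T) : Prop :=
  ~ countable A /\
  forall (U : Type) (B : set U), ~ countable B -> A #<= B.

Definition card_lt (T U : Type) (A : set T) (B : set U) : Prop :=
  A #<= B /\ ~ (B #<= A).

(* aleph_1 < b. Both cardinals exist and are unique by choice, so the inequality
   does not depend on the sets representing them. *)
Definition aleph1_lt_bounding_number : Prop :=
  forall (T : Type) (A : set T) (F : set (nat -> nat)),
    has_card_aleph1 A -> has_card_bounding_number F -> card_lt A F.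

Section Coarse.
Variable R : realType.

(* Functions [0, +oo[ -> [0, +oo[ are functions R -> R constrained only on
   nonnegative arguments; their values at negative reals are irrelevant. *)
Definition nondecreasing_nonneg (f : R -> R) : Prop :=
  (forall t, 0 <= t -> 0 <= f t) /\
  (forall s t, 0 <= s -> s <= t -> f s <= f t).

Definition moduli (kappa omega : R -> R) : Prop :=
  [/\ nondecreasing_nonneg kappa, nondecreasing_nonneg omega &
      kappa t @[t --> +oo] --> +oo].

Definition coarse_embedding (kappa omega : R -> R) (X Y : metricType R)
    (phi : X -> Y) : Prop :=
  forall x x' : X,
    kappa (mdist x x') <= mdist (phi x) (phi x') <= omega (mdist x x').

Definition coarsely_embeds (X Y : metricType R) : Prop :=
  exists (phi : X -> Y) (kappa omega : R -> R),
    moduli kappa omega /\ coarse_embedding kappa omega phi.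

Definition equi_coarsely_embeds (I : Type) (X : I -> metricType R)
    (J : set I) (Y : metricType R) : Prop :=
  exists kappa omega : R -> R, moduli kappa omega /\
    forall i, J i -> exists phi : X i -> Y, coarse_embedding kappa omega phi.

End Coarse.

(* Main.v *)
Require Import Defs.
From mathcomp Require Import all_boot all_order all_algebra.
From mathcomp Require Import boolp classical_sets functions cardinality.
From mathcomp Require Import reals topology normedtype.

(** Each pair of moduli [(kappa, omega)] is encoded by a single function
    [f : nat -> nat] that bounds [omega] from above and the growth rate of
    [kappa] from below. Since [aleph_1 < b], the codes of [aleph_1] many of the
    spaces are eventually dominated by one function [g]; the threshold beyond
    which [g] dominates is a natural number, so it takes the same value [n] for
    uncountably many of them. Common moduli are then read off [g] and [n]. *)

Import Order.TTheory GRing.Theory Num.Theory.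
Import numFieldNormedType.Exports.

Local Open Scope classical_set_scope.
Local Open Scope card_scope.
Local Open Scope ring_scope.

Lemma card_le_rel (T U : Type) (A : set T) (B : set U) (r : T -> U -> Prop) :
  (forall x, A x -> exists2 y, B y & r x y) ->
  (forall x x' y, r x y -> r x' y -> x = x') -> A #<= B.
Proof.
move=> tot_r inj_r.
have pick (x : A) : {y : U | B y /\ r (val x) y}.
  by apply: cid; have [y By rxy] := tot_r _ (set_valP x); exists y.
pose f (x : A) : B := SigSub (mem_set (svalP (pick x)).1).
apply/card_leP/injfunPex; exists f => // x x' _ _ /(congr1 val) /= eq_f.
apply: val_inj; apply: (inj_r _ _ (sval (pick x)) (svalP (pick x)).2).
by rewrite eq_f; exact: (svalP (pick x')).2.
Qed.

(* Zorn's lemma gives a maximal set [M] of points of the product of the [X j]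
   on which every projection is injective; by maximality, some projection of
   [M] is onto its factor. *)
Lemma exists_card_min (J : Type) (T : J -> Type) (X : forall j, set (T j)) :
  J -> exists j0, forall j, X j0 #<= X j.
Proof.
move=> jJ.
pose P (M : set (forall j, T j)) := (forall m, M m -> forall j, X j (m j)) /\
  (forall m m' j, M m -> M m' -> m j = m' j -> m = m').
have [F FP totF|M [[MX Minj] Mmax]] := @Zorn_bigcup _ P.
  split=> [m [M FM Mm]|m m' j [M FM Mm] [M' FM' M'm']].
    exact: (FP _ FM).1.
  have [MM'|M'M] := totF _ _ FM FM'.
    exact: (FP _ FM').2 (MM' _ Mm) M'm'.
  exact: (FP _ FM).2 Mm (M'M _ M'm').
have [j0 surj] : exists j0, forall x, X j0 x -> exists2 m, M m & m j0 = x.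
  apply: contrapT => /forallNP nsurj.
  have new j : {x | X j x /\ forall m, M m -> m j <> x}.
    apply: cid; have /existsNP[x /not_implyP[Xx nx]] := nsurj j.
    by exists x; split=> // m Mm mx; apply: nx; exists m.
  (* Every coordinate of [m0] avoids the values that [M] takes there, so adding [m0] keeps all
     projections injective. *)
  pose m0 j := sval (new j).
  have m0P j : X j (m0 j) /\ forall m, M m -> m j <> m0 j := svalP (new j).
  apply: (Mmax (M `|` [set m0])).
    split; first exact: subsetUl.
    by move=> /(_ m0 (or_intror erefl)) /(m0P jJ).2; apply.
  split=> [m [Mm|->]|m m' j [Mm|->] [Mm'|->]] //.
  - exact: MX.
  - by move=> j; exact: (m0P j).1.
  - exact: Minj.
  - by move=> /((m0P j).2 _ Mm).
  - by move=> /esym/((m0P j).2 _ Mm').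
exists j0 => j.
apply: (@card_le_rel _ _ _ _ (fun x y => exists m, [/\ M m, m j0 = x & m j = y])).
  move=> x /surj[m Mm mx]; exists (m j); first exact: MX.
  by exists m.
by move=> x x' y [m [Mm <- my]] [m' [Mm' <- m'y]]; rewrite (Minj m m' j) ?my.
Qed.

Lemma card_le_total (T U : Type) (A : set T) (B : set U) : A #<= B \/ B #<= A.
Proof.
pose X (b : bool) : set (if b then T else U) :=
  match b with true => A | false => B end.
have [[] leX] := @exists_card_min _ _ X true.
- by left; exact: (leX false).
- by right; exact: (leX true).
Qed.

(** Take [A] of least cardinality among the uncountable subsets of [S]. An uncountable [B] in
    another type either is at least as large as [A], or is equipotent to a subset of [A], which
    competes in that minimum. *)
Lemma exists_card_aleph1 (T : Type) (S : set T) : ~ countable S ->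
  exists2 A, A `<=` S & has_card_aleph1 A.
Proof.
move=> ncS.
pose P (A : set T) := A `<=` S /\ ~ countable A.
have [[A [AS ncA]] minA] :=
  @exists_card_min {A | P A} _ sval (exist P S (conj (@subset_refl _ S) ncS)).
exists A => //; split=> // U B ncB.
have [//|/card_subP[C CB CA]] := card_le_total _ _ A B.
rewrite -(card_le_eqr CB).
have ncC : ~ countable C by rewrite (eq_countable CB).
exact: (minA (exist P C (conj (subset_trans CA AS) ncC))).
Qed.

(** If the image were unbounded, an unbounded family [F] of least cardinality would exist and embed
    into the image, hence into [A], against [hb]. *)
Lemma bounded_of_card_aleph1 (hb : aleph1_lt_bounding_number) (T : Type)
  (A : set T) (f : T -> nat -> nat) :
  has_card_aleph1 A -> bounded_family (f @` A).
Proof.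
move=> A1; apply: contrapT => unbF.
have [[F unbounded_F] minF] :=
  @exists_card_min {G | unbounded_family G} _ sval (exist unbounded_family _ unbF).
have bF : has_card_bounding_number F.
  by split=> // G unbG; exact: minF (exist unbounded_family G unbG).
have [_] := hb _ _ _ A1 bF; apply.
exact: card_le_trans (minF (exist unbounded_family _ unbF)) (card_image_le f A).
Qed.

Lemma uncountable_lt_from (hb : aleph1_lt_bounding_number) (I : Type)
  (f : I -> nat -> nat) : ~ countable [set: I] ->
  exists g n,
    ~ countable [set i | forall m, (n <= m)%N -> (f i m < g m)%N].
Proof.
move=> /exists_card_aleph1[A _ A1].
have [g gP] := bounded_of_card_aleph1 hb _ _ f A1.
exists g; apply: contrapT => /forallNP cnt; apply: A1.1.
(* The sets [D n] cover [A]; were they all countable, [A] would be too. *)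
pose D n := [set i | forall m, (n <= m)%N -> (f i m < g m)%N].
apply: (@sub_countable _ _ _ (\bigcup_(n in [set: nat]) D n)).
  apply: subset_card_le => i Ai.
  have [|n fg] := gP (f i); first by exists i.
  by exists n.
by apply: bigcup_countable => // n _; exact: contrapT (cnt n).
Qed.

Section Moduli.
Context {R : realType}.
Implicit Types (kappa omega : R -> R) (f g : nat -> nat).

(** Both clauses persist when [f m] is enlarged, which is why domination by a common [g] is
    enough. *)
Definition encodes f kappa omega := forall m,
  omega m%:R <= (f m)%:R /\ forall t, (f m)%:R <= t -> m%:R <= kappa t.

Lemma exists_encodes kappa omega :
  moduli kappa omega -> exists f, encodes f kappa omega.
Proof.
move=> [_ _ /cvgryPge kappaoo].
suff /choice[f fP] : forall m, exists k : nat,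
    omega m%:R <= k%:R /\ forall t, k%:R <= t -> m%:R <= kappa t.
  by exists f.
move=> m; have [M [_ MP]] := kappaoo m%:R.
have lt_truncn (x : R) : x < (Num.truncn x).+1%:R.
  exact/real_truncnS_gt/num_real.
(* The successors make the bounds strict: [kappa] is at least [m] only strictly beyond [M]. *)
exists (maxn (Num.truncn (omega m%:R)).+1 (Num.truncn M).+1); split.
  by rewrite (le_trans (ltW (lt_truncn _))) // ler_nat leq_maxl.
move=> t le_t; apply: MP; apply: lt_le_trans (lt_truncn M) _.
by apply: le_trans le_t; rewrite ler_nat leq_maxr.
Qed.

(** A generalized inverse of [g] on [[n, oo)], equal to 0 if no [m] qualifies. The cap [m <= N]
    keeps the maximum finite even when [g] is bounded. *)
Definition lower_nat g n N :=
  \max_(m < N.+1 | (n <= m)%N && (g m <= N)%N) (m : nat).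

(** A running maximum, since [g] need not be monotone. Its last index [n + N + 1] is past the
    threshold [n] and exceeds every real with integer part [N]. *)
Definition upper_nat g n N := \max_(m < (n + N).+2) g m.

Lemma leq_lower_nat g n m N :
  (n <= m)%N -> (g m <= N)%N -> (m <= N)%N -> (m <= lower_nat g n N)%N.
Proof.
move=> nm gm; rewrite -ltnS => mN.
by apply: (@leq_bigmax_cond _ _ _ (Ordinal mN)); rewrite /= nm.
Qed.

Lemma leq_upper_nat g n m N :
  (m <= (n + N).+1)%N -> (g m <= upper_nat g n N)%N.
Proof. by rewrite -ltnS => mN; exact: (@leq_bigmax _ _ (Ordinal mN)). Qed.

Lemma lower_nat_homo g n : {homo lower_nat g n : N N' / (N <= N')%N}.
Proof.
move=> N N' le_NN'; apply/bigmax_leqP => -[m /= mN] /andP[nm gm].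
by apply: leq_lower_nat => //; apply: leq_trans le_NN'.
Qed.

Lemma upper_nat_homo g n : {homo upper_nat g n : N N' / (N <= N')%N}.
Proof.
move=> N N' le_NN'; apply/bigmax_leqP => -[m /= mN] _.
by apply: leq_upper_nat; rewrite -ltnS (leq_trans mN)// !ltnS leq_add2l.
Qed.

Definition lower_modulus g n (t : R) : R := (lower_nat g n (Num.truncn t))%:R.

Definition upper_modulus g n (t : R) : R := (upper_nat g n (Num.truncn t))%:R.

Lemma moduli_lower_upper g n : moduli (lower_modulus g n) (upper_modulus g n).
Proof.
split; [split=> [//|s t _ st] | split=> [//|s t _ st] | ].
- by rewrite ler_nat lower_nat_homo ?le_truncn.
- by rewrite ler_nat upper_nat_homo ?le_truncn.
apply/cvgryPge => A.
(* This [m] exceeds [A] and qualifies in the maximum once [t] is beyond both [m] and [g m]. *)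
pose m := maxn n (Num.truncn A).+1.
exists (maxn (g m) m)%:R; split=> [|t /ltW lt_t]; first exact: num_real.
apply: (@le_trans _ _ m%:R).
  rewrite ltW // (lt_le_trans (real_truncnS_gt (num_real A))) //.
  by rewrite ler_nat leq_maxr.
have t0 : 0 <= t := le_trans (ler0n _ _) lt_t.
rewrite ler_nat; apply: leq_lower_nat; first exact: leq_maxl.
  by rewrite truncn_ge_nat // (le_trans _ lt_t) // ler_nat leq_maxl.
by rewrite truncn_ge_nat // (le_trans _ lt_t) // ler_nat leq_maxr.
Qed.

Lemma lower_upper_bounds kappa omega f g n t :
  moduli kappa omega -> encodes f kappa omega ->
  (forall m, (n <= m)%N -> (f m < g m)%N) -> 0 <= t ->
  lower_modulus g n t <= kappa t /\ omega t <= upper_modulus g n t.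
Proof.
move=> [[kappa0 _] [_ omega_homo] _] fP fg t0; split.
- rewrite /lower_modulus /lower_nat.
  (* The default 0 is below [kappa t] by nonnegativity; a qualifying [m] has [f m < g m <= t], so
     [m <= kappa t]. *)
  elim/big_ind: _ => [|x y xk yk|m /andP[nm gm]].
  + exact: kappa0.
  + by rewrite /maxn; case: ifP.
  + apply: (fP m).2; apply: le_trans (_ : (g m)%:R <= t).
      by rewrite ler_nat ltnW // fg.
    by rewrite -truncn_ge_nat.
- set N := Num.truncn t.
  (* Monotonicity of [omega] moves [t] up to an integer where [g] already dominates [f]. *)
  have le_t : t <= (n + N).+1%:R.
    rewrite ltW // (lt_le_trans (real_truncnS_gt (num_real t))) //.
    by rewrite ler_nat ltnS leq_addl.
  apply: le_trans (omega_homo _ _ t0 le_t) _.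
  apply: le_trans (fP (n + N).+1).1 _.
  rewrite ler_nat (leq_trans (ltnW (fg _ _))) ?leq_upper_nat //.
  by rewrite ltnW // ltnS leq_addr.
Qed.

End Moduli.

Theorem proposition3p3 (hb : aleph1_lt_bounding_number)
  (R : realType) (Y : metricType R) (I : Type) (X : I -> metricType R)
  (hI : ~ countable [set: I])
  (hX : forall i : I, coarsely_embeds (X i) Y) :
  exists J : set I, ~ countable J /\ equi_coarsely_embeds X J Y.
Proof.
have /choice[f fP] : forall i, exists f : nat -> nat,
    exists (phi : X i -> Y) (kappa omega : R -> R),
      [/\ moduli kappa omega, coarse_embedding kappa omega phi
        & encodes f kappa omega].
  move=> i; have [phi [kappa [omega [mod_ko emb]]]] := hX i.
  have [f enc] := exists_encodes _ _ mod_ko.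
  by exists f, phi, kappa, omega.
have [g [n uncountable_J]] := uncountable_lt_from hb I f hI.
exists [set i | forall m, (n <= m)%N -> (f i m < g m)%N]; split=> //.
exists (lower_modulus g n), (upper_modulus g n); split.
  exact: moduli_lower_upper.
move=> i fg; have [phi [kappa [omega [mod_ko emb enc]]]] := fP i.
(* The original map is kept; only its moduli are relaxed to the common ones. *)
exists phi => x x'; have /andP[le_k le_o] := emb x x'.
have [lo up] := lower_upper_bounds _ _ _ _ _ _ mod_ko enc fg (mdist_ge0 x x').
by rewrite (le_trans lo le_k) (le_trans le_o up).
Qed.
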